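(* For $n\ge0$, $$B_n(x,f,g,h\,|\,t,\alpha)=\sum_{k=0}^{\lfloor n/2\rfloor}\gamma^b_{n,k}(f)\,x^k(1+x)^{n-2k},$$ where $$\gamma^b_{n,k}(f)=\sum_{\sigma\in\mathfrak{S}_{n+1,\mathrm{des}=k}^{\mathrm{dd}=0}}f^{\mathrm{lmaxpk}(\sigma)-1}g^{\mathrm{rmaxpk}(\sigma)-1}h^{\mathrm{D}(\sigma)}t^{\mathrm{lmaxda}(\sigma)}\alpha^{\mathrm{lmax}(\sigma)+\mathrm{rmax}(\sigma)-2}.$$
   Context: $\mathfrak{S}_N$ is the set of permutations $\sigma=\sigma_1\cdots\sigma_N$ of $[N]$. With the convention $\sigma_0=\sigma_{N+1}=0$, a letter $\sigma_i$ ($i\in[N]$) is a valley if $\sigma_{i-1}>\sigma_i<\sigma_{i+1}$, a peak if $\sigma_{i-1}<\sigma_i>\sigma_{i+1}$, a double ascent if $\sigma_{i-1}<\sigma_i<\sigma_{i+1}$, a double descent if $\sigma_{i-1}>\sigma_i>\sigma_{i+1}$. $\mathrm{Val}(\sigma)$, $\mathrm{Pk}(\sigma)$ are the sets of letters that are valleys, peaks; $\mathrm{dd}(\sigma)$ is the number of double descents; $\mathrm{des}(\sigma)=\#\{1\le i\le N-1:\sigma_i>\sigma_{i+1}\}$. A letter is a left-to-right (resp. right-to-left) maximum if it is larger than all letters to its left (resp. right); $\mathrm{lmax}$, $\mathrm{rmax}$ count these. $\mathrm{lmaxpk}$, $\mathrm{lmaxda}$ count left-to-right maxima that are peaks, resp.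 double ascents; $\mathrm{rmaxpk}$, $\mathrm{rmaxdd}$ count right-to-left maxima that are peaks, resp. double descents. For $\sigma\in\mathfrak{S}_N$, $\mathrm{D}(\sigma)=\sum_{i\in\mathrm{Pk}(\sigma)\setminus\{N\}}i-\sum_{j\in\mathrm{Val}(\sigma)}j$. Define $$B_n(x,f,g,h\,|\,t,\alpha)=\sum_{\sigma\in\mathfrak{S}_{n+1}}x^{\mathrm{des}(\sigma)}f^{\mathrm{lmaxpk}(\sigma)-1}g^{\mathrm{rmaxpk}(\sigma)-1}h^{\mathrm{D}(\sigma)}t^{\mathrm{lmaxda}(\sigma)+\mathrm{rmaxdd}(\sigma)}\alpha^{\mathrm{lmax}(\sigma)+\mathrm{rmax}(\sigma)-2}$$ and $\mathfrak{S}_{N,\mathrm{des}=k}^{\mathrm{dd}=0}=\{\sigma\in\mathfrak{S}_N:\mathrm{dd}(\sigma)=0,\ \mathrm{des}(\sigma)=k\}$. *)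

(* Defs.v *)
(* Permutation statistics, in the MathComp library. *)
From HB Require Import structures.
From mathcomp Require Import all_boot all_order all_fingroup all_algebra.

Set Implicit Arguments.
Unset Strict Implicit.
Unset Printing Implicit Defensive.

Import GRing.Theory.
Local Open Scope ring_scope.

(* ['S_N] permutes {0, ..., N-1}, whereas words have positions 1, ..., N and
   letters in {1, ..., N}; [letter s i] is the letter at position [i], with
   the convention that it is 0 at positions 0 and N+1. *)
Definition letter (N : nat) (s : 'S_N) (i : nat) : nat :=
  if i is j.+1 then oapp (fun k : 'I_N => (s k).+1) 0%N (insub j) else 0%N.

(* The following predicates are about the letter at position [i], for
   1 <= i <= N. *)
Definition valley (N : nat) (s : 'S_N) (i : nat) : bool :=
  ((letter s i < letter s i.-1) && (letter s i < letter s i.+1))%N.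

Definition peak (N : nat) (s : 'S_N) (i : nat) : bool :=
  ((letter s i.-1 < letter s i) && (letter s i.+1 < letter s i))%N.

Definition dascent (N : nat) (s : 'S_N) (i : nat) : bool :=
  (letter s i.-1 < letter s i < letter s i.+1)%N.

Definition ddescent (N : nat) (s : 'S_N) (i : nat) : bool :=
  (letter s i.+1 < letter s i < letter s i.-1)%N.

Definition is_lmax (N : nat) (s : 'S_N) (i : nat) : bool :=
  all (fun j => letter s j < letter s i)%N (index_iota 1 i).

Definition is_rmax (N : nat) (s : 'S_N) (i : nat) : bool :=
  all (fun j => letter s j < letter s i)%N (index_iota i.+1 N.+1).

Definition positions (N : nat) : seq nat := index_iota 1 N.+1.

(* Unlike the predicates above, these are sets of letters, not of positions. *)
Definition Val (N : nat) (s : 'S_N) : {set 'I_N.+1} :=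
  [set a : 'I_N.+1 |
    (a : nat) \in [seq letter s i | i <- positions N & valley s i]].

Definition Pk (N : nat) (s : 'S_N) : {set 'I_N.+1} :=
  [set a : 'I_N.+1 |
    (a : nat) \in [seq letter s i | i <- positions N & peak s i]].

Definition des (N : nat) (s : 'S_N) : nat :=
  count (fun i => letter s i.+1 < letter s i)%N (index_iota 1 N).

Definition dd (N : nat) (s : 'S_N) : nat := count (ddescent s) (positions N).

Definition lmax (N : nat) (s : 'S_N) : nat := count (is_lmax s) (positions N).

Definition rmax (N : nat) (s : 'S_N) : nat := count (is_rmax s) (positions N).

Definition lmaxpk (N : nat) (s : 'S_N) : nat :=
  count (fun i => is_lmax s i && peak s i) (positions N).

Definition lmaxda (N : nat) (s : 'S_N) : nat :=
  count (fun i => is_lmax s i && dascent s i) (positions N).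

Definition rmaxpk (N : nat) (s : 'S_N) : nat :=
  count (fun i => is_rmax s i && peak s i) (positions N).

Definition rmaxdd (N : nat) (s : 'S_N) : nat :=
  count (fun i => is_rmax s i && ddescent s i) (positions N).

(* [ord_max : 'I_N.+1] is the letter N. *)
Definition Dstat (N : nat) (s : 'S_N) : int :=
  \sum_(i in Pk s :\ ord_max) (i : nat)%:Z - \sum_(j in Val s) (j : nat)%:Z.

(* The exponents involving a subtraction are integers, so that no truncated
   subtraction occurs; this is why the ring has to be a [comUnitRingType].
   They are in fact nonnegative, so taking R to be a polynomial ring over
   [int] and the arguments to be its variables gives the generating
   polynomial itself. *)
Definition Bpoly (R : comUnitRingType) (n : nat) (x f g h t alpha : R) : R :=
  \sum_(s : 'S_n.+1)
     x ^+ des s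
     * f ^ ((lmaxpk s)%:Z - 1)
     * g ^ ((rmaxpk s)%:Z - 1)
     * h ^ Dstat s
     * t ^+ (lmaxda s + rmaxdd s)
     * alpha ^ ((lmax s + rmax s)%:Z - 2).

Definition perms_dd0_des (N k : nat) : {set 'S_N} :=
  [set s : 'S_N | (dd s == 0%N) && (des s == k)].

Definition gammab (R : comUnitRingType) (n k : nat) (f g h t alpha : R) : R :=
  \sum_(s in perms_dd0_des n.+1 k)
     f ^ ((lmaxpk s)%:Z - 1)
     * g ^ ((rmaxpk s)%:Z - 1)
     * h ^ Dstat s
     * t ^+ lmaxda s
     * alpha ^ ((lmax s + rmax s)%:Z - 2).

(* Main.v *)
Require Import Defs.
From HB Require Import structures.
From mathcomp Require Import all_boot all_order all_fingroup all_algebra.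
From mathcomp Require Import zify.

Set Implicit Arguments.
Unset Strict Implicit.
Unset Printing Implicit Defensive.

(** Why the theorem holds.  Let N = n + 1.  Read a permutation A N B of
    {1, ..., N} cyclically, with one extra letter 0 standing for both zero
    boundaries, and cut the cycle at N instead of at 0: this gives the word u = B 0 A on {0, ..., N-1}
    ([unroll] goes back).  For a letter y let L_y and R_y be the maximal blocks
    of letters smaller than y immediately to the left and right of y in u, that
    is, the subtrees of y in the decreasing binary tree of u.  All the
    statistics can be read off from them: the left (right) neighbour of y is
    smaller than y iff L_y (R_y) is nonempty, and y is a left-to-right
    (right-to-left) maximum iff 0 lies in L_y (in R_y), see [side_unroll].

    Exchanging the two subtrees of x, [flip], exchanges L_x and R_x and changes
    no other block except by reordering its letters.  Hence flipping a letter x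
    with exactly one nonempty block turns a double ascent into a double descent
    and conversely, makes a left-to-right maximum that is a double ascent a
    right-to-left maximum that is a double descent, and leaves the types and
    records of all other letters alone.  So the weight without the power of x
    is invariant ([weight_toggled]); note that ordinary valley hopping inside
    the permutation itself does not preserve records, which is why the cycle
    has to be cut at N.

    The number of descents is one less than the number of peaks plus double
    descents.  Pairing u with its flip, one letter at a time, replaces the
    factor x for a double descent and 1 for a double ascent by the factors 0
    and 1 + x ([sum_toggle]).  What survives are the permutations without
    double descents; there are N + 1 comparisons between neighbours, boundaries
    included, so with k descents such a permutation has n - 2k double ascents
    ([dd0_da]). *)

Import GRing.Theory.
Local Open Scope ring_scope.

(** * Trading double descents for factors 1 + x *)

(** The involution pairs each da with a dd, whose factor x is handed over to its
    partner; everything else in the summand is common to both. *)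
Lemma sum_toggle1 (R : comNzRingType) (T : eqType) (r : seq T) (phi : T -> T)
    (da dd : pred T) (C : T -> R) (x : R) :
  uniq r -> {in r, forall t, phi t \in r} -> {in r, involutive phi} ->
  {in r, forall t, dd (phi t) = da t} -> (forall t, ~~ (da t && dd t)) ->
  {in r, forall t, C (phi t) = C t} ->
  \sum_(t <- r) C t * (if dd t then x else 1) =
  \sum_(t <- r) C t * (if da t then 1 + x else if dd t then 0 else 1).
Proof.
move=> r_uniq phi_r phiK dd_phi da_dd C_phi.
have perm_phi : perm_eq (map phi r) r.
  rewrite perm_sym; apply: uniq_perm => //.
    by rewrite map_inj_in_uniq // => s t sr tr e; rewrite -(phiK s) // e phiK.
  move=> t; apply/idP/mapP => [tr | [s sr ->]]; last exact: phi_r.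
  by exists (phi t); rewrite ?phi_r ?phiK.
have move_dd : \sum_(t <- r | dd t) C t * x = \sum_(t <- r | da t) C t * x.
  rewrite -(perm_big _ perm_phi) big_map big_seq_cond [RHS]big_seq_cond.
  by apply: eq_big => [t | t /andP[tr _]]; last rewrite C_phi //;
    case: (boolP (t \in r)) => //= tr; rewrite dd_phi.
have split_at (v : T -> R) : \sum_(t <- r) v t =
    \sum_(t <- r | da t) v t + \sum_(t <- r | dd t) v t
    + \sum_(t <- r | ~~ da t && ~~ dd t) v t.
  rewrite (bigID da) /= -addrA; congr (_ + _); rewrite (bigID dd) /=.
  congr (_ + _); apply: eq_bigl => t.
  by move: (da_dd t); case: (da t); case: (dd t).
rewrite !split_at; congr (_ + _); last first.
  by apply: eq_bigr => t /andP[/negPf-> /negPf->].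
rewrite [X in _ + X = _](eq_bigr (fun t => C t * x)) => [|t -> //].
rewrite move_dd -big_split /= [X in _ = _ + X]big1 => [|t dt].
  rewrite addr0; apply: eq_bigr => t dt; rewrite dt mulrDr.
  by move: (da_dd t); rewrite dt /= => /negPf ->.
by move: (da_dd t); rewrite dt andbT => /negPf ->; rewrite mulr0.
Qed.

(** Letters are treated one after the other, so the involutions need not
    commute: once the letter i is settled, its new factor is invariant under
    the involutions of the remaining letters and joins the weight K. *)
Lemma sum_toggle (R : comNzRingType) (T : eqType) (r : seq T) (J : seq nat)
    (phi : nat -> T -> T) (da dd : nat -> pred T) (K : T -> R) (x : R) :
  uniq r -> uniq J ->
  {in J & r, forall i t, phi i t \in r} ->
  {in J & r, forall i t, phi i (phi i t) = t} ->
  {in J & r, forall i t, dd i (phi i t) = da i t} ->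
  (forall i t, ~~ (da i t && dd i t)) ->
  {in J & r, forall i t, K (phi i t) = K t} ->
  {in J &, forall i j, j != i -> {in r, forall t,
     da j (phi i t) = da j t /\ dd j (phi i t) = dd j t}} ->
  \sum_(t <- r) K t * \prod_(i <- J) (if dd i t then x else 1) =
  \sum_(t <- r) K t *
     \prod_(i <- J) (if da i t then 1 + x else if dd i t then 0 else 1).
Proof.
move=> r_uniq; elim: J K => [|i J IH] K /=; first by move=> *;
  apply: eq_bigr => t _; rewrite !big_nil.
move=> /andP[iJ J_uniq] phi_r phiK dd_phi da_dd K_phi far.
have J_in j : j \in J -> j \in i :: J by rewrite inE => ->; rewrite orbT.
have iiJ : i \in i :: J by rewrite inE eqxx.
have neq_i j : j \in J -> j != i by move=> jJ; apply: contraNneq iJ => <-.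
under eq_bigr do rewrite big_cons mulrCA mulrC.
rewrite (@sum_toggle1 _ _ _ (phi i) (da i)) //.
- under [RHS]eq_bigr do rewrite big_cons mulrA.
  rewrite -IH //.
  + by apply: eq_bigr => t _; rewrite mulrAC.
  + by move=> j t /J_in; apply: phi_r.
  + by move=> j t /J_in; apply: phiK.
  + by move=> j t /J_in; apply: dd_phi.
  + move=> j t jJ tr; rewrite (K_phi _ _ (J_in _ jJ) tr).
    have ij : i != j by rewrite eq_sym neq_i.
    by have [-> ->] := far _ _ (J_in _ jJ) iiJ ij _ tr.
  + by move=> j k /J_in jJ /J_in; apply: far.
- by move=> t; apply: phi_r.
- by move=> t; apply: phiK.
- by move=> t; apply: dd_phi.
move=> t tr; rewrite K_phi //; congr (_ * _); apply: eq_big_seq => j jJ.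
by have [_ ->] := far _ _ iiJ (J_in _ jJ) (neq_i _ jJ) _ tr.
Qed.

Local Open Scope nat_scope.

(** * Blocks of smaller letters and the flip at a letter *)

Fixpoint below (y : nat) (s : seq nat) : seq nat :=
  if s is z :: s' then if z < y then z :: below y s' else [::] else [::].

Definition beyond (y : nat) (s : seq nat) : seq nat := drop (size (below y s)) s.

Definition before (y : nat) (u : seq nat) := take (index y u) u.
Definition after (y : nat) (u : seq nat) := drop (index y u).+1 u.

Definition right_block (y : nat) (u : seq nat) : seq nat := below y (after y u).

(** In the form p ++ l ++ x :: r ++ q of [factored] this exchanges l and r; see
    [flipE]. *)
Definition flip (x : nat) (u : seq nat) : seq nat :=
  rev (beyond x (rev (before x u))) ++ below x (after x u)
  ++ x :: rev (below x (rev (before x u))) ++ beyond x (after x u).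

(** Says that l and r are exactly the left and right blocks of x in
    p ++ l ++ x :: r ++ q.  The default x.+1 lets an empty p or q stand for a
    boundary larger than x. *)
Definition factored (x : nat) (p l r q : seq nat) : bool :=
  [&& all (gtn x) l, all (gtn x) r, x < last x.+1 p & x < head x.+1 q].

Lemma before_cat y a b : y \notin a -> before y (a ++ y :: b) = a.
Proof.
by move=> ya; rewrite /before index_cat (negPf ya) /= eqxx addn0 take_size_cat.
Qed.

Lemma after_cat y a b : y \notin a -> after y (a ++ y :: b) = b.
Proof.
move=> ya; rewrite /after index_cat (negPf ya) /= eqxx addn0.
by rewrite -cat_rcons drop_size_cat // size_rcons.
Qed.

Lemma split_letter (y : nat) (u : seq nat) : y \in u -> uniq u ->
  exists a b, [/\ u = a ++ y :: b, y \notin a & y \notin b].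
Proof.
move=> yu; case/splitPr: yu => a b; rewrite uniq_catC /= => /andP[].
by rewrite mem_cat => /norP[yb ya] _; exists a, b.
Qed.

Lemma below_cat y s1 s2 :
  below y (s1 ++ s2) = if all (gtn y) s1 then s1 ++ below y s2 else below y s1.
Proof. by elim: s1 => //= z s1 ->; case: (z < y) => //=; case: ifP. Qed.

Lemma below_all y s : all (gtn y) (below y s).
Proof. by elim: s => //= z s IH; case: ifP => //= ->. Qed.

Lemma cat_below_beyond y s : below y s ++ beyond y s = s.
Proof.
rewrite /beyond; elim: s => //= z s IH; case: ifP => //= _.
by rewrite IH.
Qed.

Lemma beyond_head y s : y \notin s -> y < head y.+1 (beyond y s).
Proof.
rewrite /beyond; elim: s => //= z s IH; rewrite inE => /norP[yz /IH{}IH].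
by case: ifP => //= zy; rewrite ltn_neqAle yz leqNgt zy.
Qed.

Lemma below_id y s t : all (gtn y) s -> y < head y.+1 t ->
  below y (s ++ t) = s.
Proof.
move=> sy ty; rewrite below_cat sy; case: t ty => [|z t] /= => [_|yz].
  by rewrite cats0.
by rewrite ltnNge ltnW //= cats0.
Qed.

Lemma head_rev (T : Type) (d : T) s : head d (rev s) = last d s.
Proof. by case/lastP: s => // s z; rewrite rev_rcons last_rcons. Qed.

Lemma last_rev (T : Type) (d : T) s : last d (rev s) = head d s.
Proof. by rewrite -head_rev revK. Qed.

Lemma factored_rev x p l r q :
  factored x (rev q) (rev r) (rev l) (rev p) = factored x p l r q.
Proof. by rewrite /factored !all_rev last_rev head_rev; do !bool_congr. Qed.

Lemma factored_sym x p l r q : factored x p r l q = factored x p l r q.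
Proof. by rewrite /factored andbCA. Qed.

Lemma rev_factors (x : nat) p l r q : rev (p ++ l ++ x :: r ++ q) =
  rev q ++ rev r ++ x :: rev l ++ rev p.
Proof. by rewrite !rev_cat rev_cons rev_cat cat_rcons -!catA. Qed.

Lemma factorP (x : nat) (u : seq nat) : x \in u -> uniq u ->
  exists p l r q, u = p ++ l ++ x :: r ++ q /\ factored x p l r q.
Proof.
move=> xu /(split_letter xu)[a [b [-> xa xb]]].
exists (rev (beyond x (rev a))), (rev (below x (rev a))).
exists (below x b), (beyond x b).
rewrite cat_below_beyond catA -rev_cat cat_below_beyond revK; split=> //.
by rewrite /factored all_rev !below_all last_rev !beyond_head ?mem_rev.
Qed.

Lemma flipE x p l r q : uniq (p ++ l ++ x :: r ++ q) -> factored x p l r q ->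
  flip x (p ++ l ++ x :: r ++ q) = p ++ r ++ x :: l ++ q.
Proof.
rewrite catA cat_uniq => /and3P[_ /hasPn/(_ x (mem_head _ _)) /= xpl _].
case/and4P=> lx rx px qx.
rewrite /flip before_cat // after_cat // below_id // rev_cat.
rewrite /beyond !below_id ?all_rev ?head_rev // !drop_size_cat //.
by rewrite !revK.
Qed.

Lemma right_block_cat y a b : y \notin a ->
  right_block y (a ++ y :: b) = below y b.
Proof. by move=> ya; rewrite /right_block after_cat. Qed.

Lemma right_block_flipped x p l r q : uniq (p ++ l ++ x :: r ++ q) ->
  factored x p l r q -> right_block x (p ++ l ++ x :: r ++ q) = r.
Proof.
rewrite catA cat_uniq => /and3P[_ /hasPn/(_ x (mem_head _ _)) /= xpl _].
by case/and4P=> lx rx px qx; rewrite right_block_cat // below_id.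
Qed.

Lemma perm_flipped (x : nat) p l r q :
  perm_eq (p ++ r ++ x :: l ++ q) (p ++ l ++ x :: r ++ q).
Proof. by apply/seq.permP => a; do !rewrite count_cat /=; lia. Qed.

Lemma notin_front (y : nat) a b : uniq (a ++ y :: b) -> y \notin a.
Proof. by rewrite cat_uniq => /and3P[_ /hasPn/(_ y (mem_head _ _))]. Qed.

(** A letter y inside a block of x is smaller than x and than whatever follows
    that block before and after the flip, so R_y ends within the block. *)
Lemma right_block_inside x y p l r q : uniq (p ++ l ++ x :: r ++ q) ->
    factored x p l r q -> y \in l ->
  right_block y (p ++ l ++ x :: r ++ q) = right_block y (p ++ r ++ x :: l ++ q).
Proof.
move=> u_uniq /and4P[lx _ _ qx] yl.
have yx : y < x by move/allP: lx => /(_ _ yl).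
case/splitPr: yl lx u_uniq => a b lx u_uniq.
have -> : p ++ (a ++ y :: b) ++ x :: r ++ q = (p ++ a) ++ y :: b ++ x :: r ++ q.
  by rewrite -!catA.
have flippedE : p ++ r ++ x :: (a ++ y :: b) ++ q
              = (p ++ r ++ x :: a) ++ y :: b ++ q.
  by rewrite -!catA.
have := u_uniq; rewrite -(perm_uniq (perm_flipped _ _ _ _ _)).
rewrite flippedE => /notin_front y_front.
rewrite !right_block_cat //; last first.
  by move: y_front; rewrite !mem_cat inE !negb_or => /and4P[-> _ _ ->].
rewrite !below_cat /=; case: ifP => // _; rewrite ltnNge ltnW //=.
case: q qx {u_uniq flippedE} => //= z q xz.
by rewrite ltnNge (ltnW (ltn_trans yx xz)).
Qed.

(** If R_y meets the factor moved by the flip while y lies outside of it, then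
    y > x, since R_y has passed the letter larger than x that bounds the factor;
    so R_y contains the whole factor, which the flip only permutes. *)
Lemma right_block_other x y p l r q :
    uniq (p ++ l ++ x :: r ++ q) -> factored x p l r q ->
    y \in p ++ l ++ x :: r ++ q -> y != x ->
  perm_eq (right_block y (p ++ l ++ x :: r ++ q))
          (right_block y (p ++ r ++ x :: l ++ q)).
Proof.
move=> u_uniq fac yu yx; have [lx rx px _] := and4P fac.
have flipped_uniq : uniq (p ++ r ++ x :: l ++ q).
  by rewrite (perm_uniq (perm_flipped x p l r q)).
move: yu; rewrite !mem_cat inE (negPf yx) mem_cat /=.
case/or4P=> [yp|yl|yr|yq].
- case/splitPr: yp px u_uniq {fac} => a b px.
  rewrite -!catA /= => /notin_front ya.
  rewrite !right_block_cat // below_cat [X in perm_eq _ X]below_cat.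
  case: ifP => // yb; rewrite perm_cat2l.
  have xy : x < y.
    move: px; rewrite last_cat /=; case/lastP: b yb => [|b z] //.
    by rewrite all_rcons last_rcons /= => /andP[zy _] xz; apply: ltn_trans zy.
  have below_y s : all (gtn x) s -> all (gtn y) s.
    by apply: sub_all => z /= zx; apply: ltn_trans xy.
  do !rewrite below_cat /=; rewrite !below_y // xy.
  exact: (perm_flipped x [::]).
- by rewrite (right_block_inside u_uniq).
- by rewrite (right_block_inside flipped_uniq _ yr) // factored_sym.
have fl c d : p ++ c ++ x :: d ++ q = (p ++ c ++ x :: d) ++ q.
  by rewrite -?catA /= -?catA.
rewrite !fl in u_uniq flipped_uniq *.
case/splitPr: yq u_uniq flipped_uniq => a b; rewrite !catA.
by move=> /notin_front yplra /notin_front yprla; rewrite !right_block_cat.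
Qed.

(** Only emptiness of the blocks and the place of 0 matter for the statistics;
    both are insensitive to the order of letters within a block. *)
Definition block_side (y : nat) (u : seq nat) : bool * bool :=
  (right_block y u != [::], 0 \in right_block y u).

(** Left side first: reversing the word turns L_y into R_y. *)
Definition block_profile (y : nat) (u : seq nat) :=
  (block_side y (rev u), block_side y u).

Definition swap (p : (bool * bool) * (bool * bool)) := (p.2, p.1).

Definition single (p : (bool * bool) * (bool * bool)) := p.1.1 != p.2.1.

(** Letters with two nonempty or two empty blocks are left alone: flipping a
    peak would exchange the counts [lmaxpk] and [rmaxpk]. *)
Definition toggle (x : nat) (u : seq nat) : seq nat :=
  if single (block_profile x u) then flip x u else u.

Lemma perm_block_side y u v :
  perm_eq (right_block y u) (right_block y v) -> block_side y u = block_side y v.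
Proof.
by move=> uv; rewrite /block_side -!size_eq0 (perm_size uv) (perm_mem uv).
Qed.

Lemma flip_perm x u : x \in u -> uniq u -> perm_eq (flip x u) u.
Proof.
move=> xu u_uniq; have [p [l [r [q [e fac]]]]] := factorP xu u_uniq.
by rewrite e in u_uniq *; rewrite (flipE u_uniq fac); apply: perm_flipped.
Qed.

Lemma flipK x u : x \in u -> uniq u -> flip x (flip x u) = u.
Proof.
move=> xu u_uniq; have [p [l [r [q [e fac]]]]] := factorP xu u_uniq.
rewrite e in u_uniq *; rewrite (flipE u_uniq fac).
have flipped_uniq : uniq (p ++ r ++ x :: l ++ q).
  by rewrite (perm_uniq (perm_flipped x p l r q)).
by rewrite -factored_sym in fac; rewrite (flipE flipped_uniq fac).
Qed.

Lemma left_block_flipped x p l r q : uniq (p ++ l ++ x :: r ++ q) ->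
  factored x p l r q -> right_block x (rev (p ++ l ++ x :: r ++ q)) = rev l.
Proof.
rewrite -rev_uniq rev_factors -factored_rev => u_uniq.
exact: right_block_flipped u_uniq.
Qed.

Lemma block_profile_flip x u : x \in u -> uniq u ->
  block_profile x (flip x u) = swap (block_profile x u).
Proof.
move=> xu u_uniq; have [p [l [r [q [e fac]]]]] := factorP xu u_uniq.
rewrite e in u_uniq *; rewrite (flipE u_uniq fac).
have flipped_uniq : uniq (p ++ r ++ x :: l ++ q).
  by rewrite (perm_uniq (perm_flipped x p l r q)).
have fac' : factored x p r l q by rewrite factored_sym.
congr pair; apply: perm_block_side.
  rewrite (left_block_flipped flipped_uniq fac') (right_block_flipped u_uniq fac).
  by rewrite perm_rev.
rewrite (left_block_flipped u_uniq fac) (right_block_flipped flipped_uniq fac').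
by rewrite perm_sym perm_rev.
Qed.

Lemma block_profile_flip_other x y u : x \in u -> y \in u -> uniq u -> y != x ->
  block_profile y (flip x u) = block_profile y u.
Proof.
move=> xu yu u_uniq yx; have [p [l [r [q [e fac]]]]] := factorP xu u_uniq.
rewrite e in u_uniq yu *; rewrite (flipE u_uniq fac).
congr pair; apply/esym/perm_block_side; last exact: right_block_other.
move: u_uniq fac yu; rewrite -rev_uniq -factored_rev -mem_rev.
rewrite !rev_factors => u_uniq fac yu.
exact: right_block_other u_uniq fac yu yx.
Qed.

Lemma single_swap p : single (swap p) = single p.
Proof. by rewrite /single eq_sym. Qed.

Lemma toggle_perm x u : x \in u -> uniq u -> perm_eq (toggle x u) u.
Proof. by rewrite /toggle; case: ifP => // _; apply: flip_perm. Qed.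

Lemma toggleK x u : x \in u -> uniq u -> toggle x (toggle x u) = u.
Proof.
move=> xu u_uniq; rewrite {2}/toggle.
case: ifP => [xs|xs]; last by rewrite /toggle xs.
by rewrite /toggle block_profile_flip // single_swap xs flipK.
Qed.

Lemma block_profile_toggle x u : x \in u -> uniq u ->
  block_profile x (toggle x u) =
  if single (block_profile x u) then swap (block_profile x u)
  else block_profile x u.
Proof. by rewrite /toggle; case: ifP => // _; apply: block_profile_flip. Qed.

Lemma block_profile_toggle_other x y u :
    x \in u -> y \in u -> uniq u -> y != x ->
  block_profile y (toggle x u) = block_profile y u.
Proof. by rewrite /toggle; case: ifP => // _; apply: block_profile_flip_other. Qed.

(** * Cutting the cyclic word at its largest letter *)

(** The two bits tell whether the right neighbour of y is smaller (0 being the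
    boundary) and whether y is a right-to-left maximum. *)
Definition side (y : nat) (w : seq nat) : bool * bool :=
  (head 0 (after y w) < y, all (gtn y) (after y w)).

Definition profile (y : nat) (w : seq nat) := (side y (rev w), side y w).

(** Reads the cycle of m :: u starting after 0; that 0 then becomes the two
    boundaries. *)
Definition unroll (m : nat) (u : seq nat) : seq nat :=
  after 0 u ++ m :: before 0 u.

Lemma unroll_cat m a b : 0 \notin a -> unroll m (a ++ 0 :: b) = b ++ m :: a.
Proof. by move=> a0; rewrite /unroll before_cat // after_cat. Qed.

Lemma unroll_rev m u : 0 \in u -> uniq u -> unroll m (rev u) = rev (unroll m u).
Proof.
move=> u0 /(split_letter u0)[a [b [-> a0 b0]]].
rewrite unroll_cat // !rev_cat !rev_cons !cat_rcons unroll_cat ?mem_rev //.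
Qed.

(** If y is to the left of 0 in u then the same letters follow y in u and in the
    unrolled word, up to 0, which u shows and the unrolled word has as its
    boundary.  If y is to the right of 0 then m stands in the unrolled word
    where u ends, which makes y not a right-to-left maximum, as 0 is not in
    R_y. *)
Lemma side_unroll m y u : 0 \in u -> uniq u -> y \in u -> 0 < y ->
  all (gtn m) u -> side y (unroll m u) = block_side y u.
Proof.
move=> u0 u_uniq yu y_gt0 um.
have ym : y < m by move/allP: um => /(_ _ yu).
have [a [b [e a0 b0]]] := split_letter u0 u_uniq.
rewrite e in u_uniq yu um *; rewrite unroll_cat //.
have my : m \notin b.
  apply/negP => mb; move/allP: um => /(_ m); rewrite mem_cat inE mb !orbT.
  by move=> /(_ isT) /=; rewrite ltnn.
move: yu; rewrite mem_cat inE (gtn_eqF y_gt0) /=.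
case/orP=> [ya | yb].
- case/splitPr: ya u_uniq a0 => c d; rewrite -catA /= => u_uniq.
  rewrite mem_cat inE !negb_or => /and3P[_ _ d0].
  have yc := notin_front u_uniq.
  have yb : y \notin b ++ m :: c.
    move: u_uniq; rewrite uniq_catC /= => /andP[+ _].
    rewrite !(mem_cat, inE) (ltn_eqF ym) /= !negb_or.
    by case: (y \in b); case: (y \in c); rewrite /= ?andbF.
  have -> : b ++ m :: c ++ y :: d = (b ++ m :: c) ++ y :: d by rewrite -catA.
  rewrite /side /block_side after_cat // right_block_cat // below_cat /= y_gt0.
  case: ifP => yd; congr pair.
  + by case: d yd {d0 u_uniq um} => [|z d] //= /andP[-> _]; rewrite ?y_gt0.
  + by rewrite mem_cat inE eqxx orbT.
  + by case: d yd {d0 u_uniq um} => [|z d] //=; case: ifP.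
  + apply/esym/negbTE; apply: contra d0 => d0.
    by rewrite -(cat_below_beyond y d) mem_cat d0.
case/splitPr: yb u_uniq b0 my um => c d.
have -> : a ++ 0 :: c ++ y :: d = (a ++ 0 :: c) ++ y :: d by rewrite -catA.
move=> u_uniq; rewrite mem_cat inE !negb_or => /and3P[_ _ d0] _ um.
have yc := notin_front u_uniq.
have -> : (c ++ y :: d) ++ m :: a = c ++ y :: d ++ m :: a by rewrite -catA.
rewrite /side /block_side right_block_cat // after_cat; last first.
  by apply: contra yc; rewrite mem_cat inE orbC => ->; rewrite orbT.
have -> : all (gtn y) (d ++ m :: a) = false.
  by rewrite all_cat /= [m < y]ltnNge (ltnW ym) andbF.
congr pair.
  by case: d {d0 u_uniq um} => [|z d] /=; [rewrite ltnNge (ltnW ym) | case: ifP].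
apply/esym/negbTE; apply: contra d0 => d0.
by rewrite -(cat_below_beyond y d) mem_cat d0.
Qed.

Lemma profile_unroll m y u : 0 \in u -> uniq u -> y \in u -> 0 < y ->
  all (gtn m) u -> profile y (unroll m u) = block_profile y u.
Proof.
move=> u0 u_uniq yu y_gt0 um; congr pair; last exact: side_unroll.
by rewrite -unroll_rev //; apply: side_unroll;
   rewrite ?mem_rev ?rev_uniq ?all_rev.
Qed.

(** The contribution of the top letter is what the exponents subtract: 1 from
    each count of peaks that are records, 2 from the number of records. *)
Lemma profile_top m u : 0 \in u -> uniq u -> 0 < m -> all (gtn m) u ->
  profile m (unroll m u) = ((true, true), (true, true)).
Proof.
move=> u0 /(split_letter u0)[a [b [-> a0 b0]]] m_gt0.
rewrite all_cat /= => /and3P[am _ bm]; rewrite unroll_cat //.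
have mem s : all (gtn m) s -> m \notin s.
  by move=> sm; apply/negP => /(allP sm) /=; rewrite ltnn.
have head_lt s : all (gtn m) s -> head 0 s < m by case: s => //= z s /andP[].
rewrite /profile rev_cat rev_cons cat_rcons /side.
by rewrite !after_cat ?mem_rev ?mem // !head_lt ?all_rev ?am ?bm.
Qed.

Lemma perm_unroll n u : perm_eq u (iota 0 n) -> 0 < n ->
  perm_eq (unroll n u) (iota 1 n).
Proof.
move=> pu n_gt0.
have u0 : 0 \in u by rewrite (perm_mem pu) mem_iota.
have u_uniq : uniq u by rewrite (perm_uniq pu) iota_uniq.
have [a [b [e a0 b0]]] := split_letter u0 u_uniq; rewrite e in pu *.
rewrite unroll_cat // -(perm_cons 0).
apply: (@perm_trans _ (n :: a ++ 0 :: b)).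
  by apply/seq.permP => P; do !rewrite ?count_cat /=; lia.
apply: (@perm_trans _ (n :: iota 0 n)); first by rewrite perm_cons.
by rewrite perm_sym -[0 :: iota 1 n]/(iota 0 n.+1) -addn1 iotaD cats1 perm_rcons.
Qed.

Lemma unroll_inj n :
  {in [pred u | perm_eq u (iota 0 n)] &, injective (unroll n)}.
Proof.
case: n => [u v /perm_nilP-> /perm_nilP-> //|n] u v pu pv.
have dec (w : seq nat) : perm_eq w (iota 0 n.+1) ->
    exists a b, [/\ w = a ++ 0 :: b, 0 \notin a & n.+1 \notin b].
  move=> pw; have w0 : 0 \in w by rewrite (perm_mem pw) mem_iota.
  have w_uniq : uniq w by rewrite (perm_uniq pw) iota_uniq.
  have [a [b [e a0 b0]]] := split_letter w0 w_uniq; exists a, b; split=> //.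
  have : n.+1 \notin w by rewrite (perm_mem pw) mem_iota ltnn andbF.
  by rewrite e; apply: contra => nb; rewrite mem_cat inE nb !orbT.
have [a [b [-> a0 nb]]] := dec u pu; have [c [d [-> c0 nd]]] := dec v pv.
rewrite !unroll_cat // => e.
have := congr1 (before n.+1) e; have := congr1 (after n.+1) e.
by rewrite !after_cat // !before_cat // => -> ->.
Qed.

(** * The statistics as functions of profiles *)

Definition is_pk (p : (bool * bool) * (bool * bool)) := p.1.1 && p.2.1.
Definition is_val (p : (bool * bool) * (bool * bool)) := ~~ p.1.1 && ~~ p.2.1.
Definition is_da (p : (bool * bool) * (bool * bool)) := p.1.1 && ~~ p.2.1.
Definition is_dd (p : (bool * bool) * (bool * bool)) := is_da (swap p).

Definition stat (n : nat) (F : (bool * bool) * (bool * bool) -> bool)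
    (w : seq nat) : nat :=
  count (fun y => F (profile y w)) (iota 1 n).

Definition word (N : nat) (s : 'S_N) : seq nat := map (letter s) (iota 1 N).

Lemma positionsE N : positions N = iota 1 N.
Proof. by rewrite /positions /index_iota subSS subn0. Qed.

Lemma letter_ord N (s : 'S_N) (j : 'I_N) : letter s j.+1 = (s j).+1.
Proof. by rewrite /letter valK. Qed.

Lemma letter_out N (s : 'S_N) i : N < i -> letter s i = 0.
Proof. by case: i => // i Ni; rewrite /letter insubF // ltnNge -ltnS Ni. Qed.

Lemma letter_gt0 N (s : 'S_N) i : i \in iota 1 N -> 0 < letter s i.
Proof.
rewrite mem_iota add1n ltnS; case: i => // i iN.
by rewrite -[i]/(nat_of_ord (Ordinal iN)) letter_ord.
Qed.

Lemma size_word N (s : 'S_N) : size (word s) = N.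
Proof. by rewrite size_map size_iota. Qed.

Lemma letter_nth N (s : 'S_N) i : letter s i = nth 0 (0 :: word s) i.
Proof.
case: i => // i; case: (ltnP i N) => iN; last first.
  by rewrite letter_out //= nth_default // size_word.
by rewrite /= (nth_map 0) ?size_iota // nth_iota.
Qed.

Lemma wordE N (s : 'S_N) : word s = [seq (s j).+1 | j <- enum 'I_N].
Proof.
rewrite /word (iotaDl 1 0) -map_comp -val_enum_ord -map_comp.
by apply: eq_map => j; rewrite -letter_ord.
Qed.

Lemma perm_word N (s : 'S_N) : perm_eq (word s) (iota 1 N).
Proof.
have word_uniq : uniq (word s).
  rewrite wordE map_inj_uniq ?enum_uniq // => i j [] /val_inj.
  exact: perm_inj.
apply: uniq_perm (iota_uniq _ _) _ => //.
have sub : {subset word s <= iota 1 N}.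
  move=> y; rewrite wordE => /mapP[j _ ->].
  by rewrite mem_iota add1n !ltnS leq0n ltn_ord.
by have [] := uniq_min_size word_uniq sub; rewrite ?size_iota ?size_word.
Qed.

Lemma word_inj N : injective (@word N).
Proof.
move=> s s' e; apply/permP => j.
have := letter_ord s j; rewrite letter_nth e -letter_nth letter_ord.
by case=> /val_inj.
Qed.

Lemma after_rev (y : nat) w : y \in w -> uniq w ->
  after y (rev w) = rev (before y w).
Proof.
move=> yw /(split_letter yw)[a [b [-> ya yb]]].
by rewrite rev_cat rev_cons cat_rcons after_cat ?mem_rev // before_cat.
Qed.

Lemma profile_letter N (s : 'S_N) i : i \in iota 1 N ->
  profile (letter s i) (word s) =
  ((letter s i.-1 < letter s i, is_lmax s i),
   (letter s i.+1 < letter s i, is_rmax s i)).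
Proof.
rewrite mem_iota add1n ltnS => /andP[i_gt0 iN].
have word_uniq : uniq (word s).
  by rewrite (perm_uniq (perm_word s)) iota_uniq.
have i1 : i.-1 < size (word s) by rewrite size_word prednK.
have letterE : letter s i = nth 0 (word s) i.-1.
  by rewrite letter_nth -{1}(prednK i_gt0).
have idx : index (letter s i) (word s) = i.-1 by rewrite letterE index_uniq.
have iw : letter s i \in word s by rewrite letterE mem_nth.
rewrite /profile /side after_rev // head_rev all_rev /before /after idx prednK //.
congr ((_, _), (_, _)).
- rewrite (last_nth 0) size_take i1 [letter s i.-1]letter_nth.
  by case: (i.-1) => //= k; rewrite nth_take.
- by rewrite -map_take take_iota (minn_idPl _) ?all_map /is_lmax /index_iota ?subn1 //;
    lia.
- by rewrite -nth0 nth_drop addn0 [letter s i.+1]letter_nth.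
by rewrite -map_drop drop_iota all_map /is_rmax /index_iota subSS add1n.
Qed.

Lemma count_letters N (s : 'S_N) (Q : pred nat) F :
  {in iota 1 N, forall i, Q i = F (profile (letter s i) (word s))} ->
  count Q (positions N) = stat N F (word s).
Proof.
move=> QF; rewrite positionsE (eq_in_count QF) -[RHS](seq.permP (perm_word s)).
by rewrite -[RHS](esym (count_map _ _ _)).
Qed.

Lemma letter_neq N (s : 'S_N) i : 0 < N -> i <= N -> letter s i != letter s i.+1.
Proof.
move=> N_gt0 iN; rewrite !letter_nth.
have word0_uniq : uniq (0 :: word s).
  rewrite /= (perm_uniq (perm_word s)) iota_uniq (perm_mem (perm_word s)).
  by rewrite mem_iota.
move: iN; rewrite leq_eqVlt => /predU1P[-> | iN].
  rewrite [nth _ _ N.+1]nth_default /= ?size_word // -letter_nth.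
  by rewrite -lt0n letter_gt0 // mem_iota N_gt0 add1n ltnSn.
by rewrite nth_uniq //= ?size_word ?neq_ltn ?ltnSn // ltnS ltnW.
Qed.

Lemma ltn_letter N (s : 'S_N) i : 0 < N -> i <= N ->
  (letter s i < letter s i.+1) = ~~ (letter s i.+1 < letter s i).
Proof.
by move=> N0 /(letter_neq s N0) ne; rewrite -leqNgt ltn_neqAle ne.
Qed.

Lemma profile_types N (s : 'S_N) i (p := profile (letter s i) (word s)) :
  i \in iota 1 N ->
  [/\ peak s i = is_pk p, valley s i = is_val p,
      dascent s i = is_da p & ddescent s i = is_dd p].
Proof.
move=> iN; rewrite /p profile_letter // /is_pk /is_val /is_dd /is_da /=.
move: iN; rewrite mem_iota add1n ltnS => /andP[i_gt0 iN].
have N_gt0 := leq_trans i_gt0 iN.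
rewrite -(ltn_letter s N_gt0 iN).
have := ltn_letter s N_gt0 (leq_trans (leq_pred i) iN); rewrite prednK //.
move=> lt_pred; rewrite lt_pred negbK; split=> //.
  by rewrite /peak lt_pred.
by rewrite /dascent lt_pred.
Qed.

Lemma lmaxE N (s : 'S_N) : lmax s = stat N (fun p => p.1.2) (word s).
Proof. by apply: count_letters => i iN; rewrite profile_letter. Qed.

Lemma rmaxE N (s : 'S_N) : rmax s = stat N (fun p => p.2.2) (word s).
Proof. by apply: count_letters => i iN; rewrite profile_letter. Qed.

Lemma lmaxpkE N (s : 'S_N) :
  lmaxpk s = stat N (fun p => p.1.2 && is_pk p) (word s).
Proof.
apply: count_letters => i iN.
by have [-> _ _ _] := profile_types s iN; rewrite profile_letter.
Qed.

Lemma rmaxpkE N (s : 'S_N) :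
  rmaxpk s = stat N (fun p => p.2.2 && is_pk p) (word s).
Proof.
apply: count_letters => i iN.
by have [-> _ _ _] := profile_types s iN; rewrite profile_letter.
Qed.

Lemma lmaxdaE N (s : 'S_N) :
  lmaxda s = stat N (fun p => p.1.2 && is_da p) (word s).
Proof.
apply: count_letters => i iN.
by have [_ _ -> _] := profile_types s iN; rewrite profile_letter.
Qed.

Lemma rmaxddE N (s : 'S_N) :
  rmaxdd s = stat N (fun p => p.2.2 && is_dd p) (word s).
Proof.
apply: count_letters => i iN.
by have [_ _ _ ->] := profile_types s iN; rewrite profile_letter.
Qed.

Lemma ddE N (s : 'S_N) : dd s = stat N is_dd (word s).
Proof. by apply: count_letters => i iN; have [_ _ _ ->] := profile_types s iN. Qed.

Lemma desE n (s : 'S_n.+1) :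
  (des s).+1 = stat n.+1 (fun p => p.2.1) (word s).
Proof.
rewrite -(count_letters (Q := fun i => letter s i.+1 < letter s i)); last first.
  by move=> i iN; rewrite profile_letter.
rewrite positionsE (_ : iota 1 n.+1 = iota 1 n ++ [:: n.+1]); last first.
  by rewrite -{1}(addn1 n) iotaD.
have last_des : letter s n.+2 < letter s n.+1.
  by rewrite letter_out // letter_gt0 // mem_iota add1n ltnSn.
rewrite count_cat (_ : count _ [:: n.+1] = (letter s n.+2 < letter s n.+1) + 0) //.
by rewrite last_des /des /index_iota subSS subn0 addn1.
Qed.

(** Each of the n + 2 pairs of neighbours, boundaries included, has exactly one
    larger element, which is a letter. *)
Lemma adjacent_pairs n (s : 'S_n.+1) :
  stat n.+1 (fun p => p.1.1) (word s) + stat n.+1 (fun p => p.2.1) (word s)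
  = n.+2.
Proof.
rewrite -desE -(count_letters (Q := fun i => letter s i.-1 < letter s i)); last first.
  by move=> i iN; rewrite profile_letter.
have -> : count (fun i => letter s i.-1 < letter s i) (positions n.+1)
        = count (fun i => letter s i < letter s i.+1) (iota 0 n.+1).
  by rewrite positionsE (iotaDl 1 0) count_map; apply: eq_count.
have -> : iota 0 n.+1 = 0 :: iota 1 n by [].
have pos1 : 0 < letter s 1 by rewrite letter_gt0 ?mem_iota.
rewrite /= pos1 /des /index_iota subSS subn0 addnS add1n addSn; congr _.+2.
rewrite (@eq_in_count _ _ (predC (fun i => letter s i.+1 < letter s i))).
  by rewrite addnC count_predC size_iota.
move=> i; rewrite mem_iota add1n ltnS => /andP[_ iN] /=.
by rewrite ltn_letter // ltnW.
Qed.

Lemma stat_pk_dd n w :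
  stat n (fun p => p.2.1) w = stat n is_pk w + stat n is_dd w.
Proof.
rewrite /stat -count_predUI (@eq_count _ (predI _ _) pred0) ?count_pred0 ?addn0.
  by apply: eq_count => y; rewrite /is_dd /is_pk /is_da /=;
    case: (_ < _); case: (_ < _).
by move=> y; rewrite /is_dd /is_pk /is_da /=; case: (_ < _); case: (_ < _).
Qed.

Lemma stat_pk_da n w :
  stat n (fun p => p.1.1) w = stat n is_pk w + stat n is_da w.
Proof.
rewrite /stat -count_predUI (@eq_count _ (predI _ _) pred0) ?count_pred0 ?addn0.
  by apply: eq_count => y; rewrite /is_pk /is_da /=;
    case: (_ < _); case: (_ < _).
by move=> y; rewrite /is_pk /is_da /=; case: (_ < _); case: (_ < _).
Qed.

Lemma dd0_da n (s : 'S_n.+1) : dd s = 0 ->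
  stat n.+1 is_da (word s) + 2 * des s = n.
Proof.
move=> dd0; have := adjacent_pairs s; have := desE s.
by rewrite stat_pk_dd stat_pk_da -ddE dd0; lia.
Qed.

Lemma dd0_des n (s : 'S_n.+1) : dd s = 0 -> des s < (n %/ 2).+1.
Proof. by move/dd0_da; lia. Qed.

Lemma mem_letters N (s : 'S_N) (F : pred nat) G a :
  {in iota 1 N, forall i, F i = G (profile (letter s i) (word s))} ->
  (a \in [seq letter s i | i <- positions N & F i]) =
  (a \in iota 1 N) && G (profile a (word s)).
Proof.
move=> FG; rewrite positionsE -(perm_mem (perm_word s)).
apply/mapP/andP => [[i]|[/mapP[i iN ->] Gi]].
  rewrite mem_filter => /andP[Fi iN] ->.
  by rewrite map_f // -FG.
by exists i => //; rewrite mem_filter FG // Gi.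
Qed.

Definition Dword (N : nat) (w : seq nat) : int :=
  (\sum_(a : 'I_N.+1 | (a != ord_max)
       && ((nat_of_ord a \in iota 1 N) && is_pk (profile a w)))
     (a : nat)%:Z
   - \sum_(a : 'I_N.+1 | (nat_of_ord a \in iota 1 N) && is_val (profile a w))
     (a : nat)%:Z)%R.

Lemma DstatE N (s : 'S_N) : Dstat s = Dword N (word s).
Proof.
congr (_ - _)%R; apply: eq_bigl => a; rewrite ?inE.
  congr (_ && _); apply: mem_letters => i iN.
  by have [-> _ _ _] := profile_types s iN.
apply: mem_letters => i iN.
by have [_ -> _ _] := profile_types s iN.
Qed.

(** * Words instead of permutations *)

Lemma perm_eq_permutations (A : seq (seq nat)) (s : seq nat) :
  uniq s -> uniq A -> {in A, forall w, perm_eq w s} -> size A = (size s)`! ->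
  perm_eq A (permutations s).
Proof.
move=> s_uniq A_uniq A_s sizeA.
have sub : {subset A <= permutations s} by move=> w /A_s; rewrite mem_permutations.
apply: uniq_perm => //; first exact: permutations_uniq.
by have [] := uniq_min_size A_uniq sub; rewrite ?size_permutations ?sizeA.
Qed.

Lemma sum_words (R : nmodType) n (F : seq nat -> R) :
  (\sum_(s : 'S_n.+1) F (word s) =
   \sum_(u <- permutations (iota 0 n.+1)) F (unroll n.+1 u))%R.
Proof.
rewrite -big_enum -(big_map _ predT F) -(big_map (unroll n.+1) predT F).
apply: perm_big.
apply: (@perm_trans _ (permutations (iota 1 n.+1))).
  apply: perm_eq_permutations; rewrite ?iota_uniq //.
  - by rewrite map_inj_uniq ?enum_uniq //; apply: word_inj.
  - by move=> w /mapP[s _ ->]; apply: perm_word.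
  by rewrite size_map size_iota -cardE card_Sn.
rewrite perm_sym; apply: perm_eq_permutations; rewrite ?iota_uniq //.
- rewrite map_inj_in_uniq ?permutations_uniq // => u v.
  by rewrite !mem_permutations; apply: unroll_inj.
- by move=> w /mapP[u + ->]; rewrite mem_permutations => /perm_unroll->.
by rewrite size_map size_permutations ?iota_uniq // !size_iota.
Qed.

(** * Invariance of the weight *)

(** Swapping is allowed at letters that are double ascents or descents only. *)
Definition toggled (n : nat) (w w' : seq nat) : Prop :=
  {in iota 1 n, forall y, profile y w' = profile y w \/
     single (profile y w) /\ profile y w' = swap (profile y w)}.

Lemma stat_toggled n w w' F : (forall p, single p -> F (swap p) = F p) ->
  toggled n w w' -> stat n F w' = stat n F w.
Proof.
move=> F_swap ww'; apply: eq_in_count => y /ww'[-> //|[ys ->]].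
exact: F_swap.
Qed.

(** This covers [lmax] + [rmax] and [lmaxda] + [rmaxdd]: neither summand is
    invariant alone, but the swap exchanges their contributions. *)
Lemma stat_sym_toggled n w w' F : toggled n w w' ->
  stat n F w' + stat n (fun p => F (swap p)) w' =
  stat n F w + stat n (fun p => F (swap p)) w.
Proof.
rewrite /toggled /stat; elim: (iota 1 n) => //= y s IH ww'.
rewrite addnACA [RHS]addnACA; congr (_ + _).
  have := ww' y (mem_head _ _); rewrite /swap.
  by case: (profile y w) => a b [-> | [_ ->]] //=; rewrite addnC.
by apply: IH => z zs; apply: ww'; rewrite inE zs orbT.
Qed.

Lemma Dword_toggled n w w' : toggled n w w' -> Dword n w' = Dword n w.
Proof.
move=> ww'; rewrite /Dword; congr (_ - _)%R; apply: eq_bigl => a.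
  congr (_ && _); case aN: (nat_of_ord a \in iota 1 n) => //=.
  by have [-> //|[_ ->]] := ww' _ aN; rewrite /is_pk andbC.
case aN: (nat_of_ord a \in iota 1 n) => //=.
by have [-> //|[_ ->]] := ww' _ aN; rewrite /is_val andbC.
Qed.

Lemma starting_word n u : perm_eq u (iota 0 n.+1) ->
  [/\ uniq u, 0 \in u, all (gtn n.+1) u & {subset iota 1 n <= u}].
Proof.
move=> pu; split.
- by rewrite (perm_uniq pu) iota_uniq.
- by rewrite (perm_mem pu) mem_iota.
- by apply/allP => y; rewrite (perm_mem pu) mem_iota.
move=> y; rewrite (perm_mem pu) !mem_iota add1n => /andP[_ yn].
by rewrite /= add0n.
Qed.

Lemma profile_unroll_small n y u : perm_eq u (iota 0 n.+1) -> y \in iota 1 n ->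
  profile y (unroll n.+1 u) = block_profile y u.
Proof.
move=> /starting_word[u_uniq u0 un sub] yn.
apply: profile_unroll => //; first exact: sub.
by move: yn; rewrite mem_iota => /andP[].
Qed.

Lemma profile_toggle_self n x u : perm_eq u (iota 0 n.+1) -> x \in iota 1 n ->
  profile x (unroll n.+1 (toggle x u)) =
  if single (profile x (unroll n.+1 u)) then swap (profile x (unroll n.+1 u))
  else profile x (unroll n.+1 u).
Proof.
move=> pu xn; have [u_uniq _ _ sub] := starting_word pu.
have xu := sub _ xn.
have pv := perm_trans (toggle_perm xu u_uniq) pu.
by rewrite !profile_unroll_small // block_profile_toggle.
Qed.

Lemma profile_toggle_other n x y u : perm_eq u (iota 0 n.+1) ->
  x \in iota 1 n -> y \in iota 1 n.+1 -> y != x ->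
  profile y (unroll n.+1 (toggle x u)) = profile y (unroll n.+1 u).
Proof.
move=> pu xn yn yx; have [u_uniq u0 un sub] := starting_word pu.
have xu := sub _ xn.
have pv := perm_trans (toggle_perm xu u_uniq) pu.
have [v_uniq v0 vn _] := starting_word pv.
have [-> | y_top] := eqVneq y n.+1; first by rewrite !profile_top.
have {}yn : y \in iota 1 n.
  by move: yn y_top; rewrite !mem_iota; lia.
by rewrite !profile_unroll_small // block_profile_toggle_other // sub.
Qed.

Lemma toggled_unroll n x u : perm_eq u (iota 0 n.+1) -> x \in iota 1 n ->
  toggled n.+1 (unroll n.+1 u) (unroll n.+1 (toggle x u)).
Proof.
move=> pu xn y yn; have [-> | yx] := eqVneq y x.
  by rewrite profile_toggle_self //; case: ifP => xs; [right | left].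
by left; apply: profile_toggle_other.
Qed.

Lemma stat_top n F u : perm_eq u (iota 0 n.+1) ->
  stat n.+1 F (unroll n.+1 u) =
  stat n F (unroll n.+1 u) + F ((true, true), (true, true)).
Proof.
move=> /starting_word[u_uniq u0 un _].
rewrite /stat -{2}(addn1 n) iotaD count_cat /= add1n profile_top //.
by rewrite addn0.
Qed.


Local Open Scope ring_scope.

Definition weight (R : comUnitRingType) (f g h t alpha : R) (N : nat)
    (w : seq nat) : R :=
  f ^ ((stat N (fun p => p.1.2 && is_pk p) w)%:Z - 1)
  * g ^ ((stat N (fun p => p.2.2 && is_pk p) w)%:Z - 1)
  * h ^ Dword N w
  * t ^+ (stat N (fun p => p.1.2 && is_da p) w
          + stat N (fun p => p.2.2 && is_dd p) w)
  * alpha ^ ((stat N (fun p => p.1.2) w + stat N (fun p => p.2.2) w)%:Z - 2).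

Lemma weight_toggled (R : comUnitRingType) (f g h t alpha : R) N w w' :
  toggled N w w' -> weight f g h t alpha N w' = weight f g h t alpha N w.
Proof.
move=> ww'; rewrite /weight (Dword_toggled ww').
rewrite (stat_sym_toggled (fun p => p.1.2 && is_da p) ww').
rewrite (stat_sym_toggled (fun p => p.1.2) ww').
rewrite (stat_toggled (F := fun p => p.1.2 && is_pk p) _ ww').
  rewrite (stat_toggled (F := fun p => p.2.2 && is_pk p) _ ww') // => p.
  by rewrite /single /is_pk /=; case: p.1.1; case: p.2.1 => //; rewrite !andbF.
move=> p.
by rewrite /single /is_pk /=; case: p.1.1; case: p.2.1 => //; rewrite !andbF.
Qed.

Lemma prod_count (R : comNzRingType) (x : R) (P : pred nat) s :
  \prod_(i <- s) (if P i then x else 1) = x ^+ count P s.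
Proof.
elim: s => [|i s IH]; first by rewrite big_nil.
by rewrite big_cons IH /=; case: (P i); rewrite ?exprS ?mul1r.
Qed.

(** * The expansion *)

(** Among the letters below the top one, those followed by a descent are the
    peaks and the double descents.  Flips fix the set of peaks, so that their
    share of the power of x goes with the invariant weight. *)
Lemma sum_dd_to_da (R : comUnitRingType) (x f g h t alpha : R) n :
  let F u := weight f g h t alpha n.+1 u * x ^+ stat n is_pk u in
  \sum_(u <- permutations (iota 0 n.+1))
     F (unroll n.+1 u) * x ^+ stat n is_dd (unroll n.+1 u) =
  \sum_(u <- permutations (iota 0 n.+1))
     F (unroll n.+1 u) * (if stat n is_dd (unroll n.+1 u) == 0%N
        then (1 + x) ^+ stat n is_da (unroll n.+1 u) else 0).
Proof.
move=> F.
pose da y u := is_da (profile y (unroll n.+1 u)).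
pose dd y u := is_dd (profile y (unroll n.+1 u)).
transitivity (\sum_(u <- permutations (iota 0 n.+1)) F (unroll n.+1 u) *
    \prod_(y <- iota 1 n) (if dd y u then x else 1)).
  by apply: eq_bigr => u _; rewrite prod_count.
rewrite (@sum_toggle _ _ _ _ toggle da).
- apply: eq_bigr => u _; congr (_ * _).
  rewrite /stat -[_ == 0%N]negbK -lt0n -has_count.
  case: hasP => [[y yn ddy] | no_dd] /=.
    rewrite (big_rem y) //= /dd ddy.
    have -> : da y u = false.
      by move: ddy; rewrite /da /is_dd /is_da /=; case: (_ < _)%N; case: (_ < _)%N.
    by rewrite mul0r.
  rewrite -prod_count; apply: eq_big_seq => y yn.
  by case ddy: (dd y u) => //; case: no_dd; exists y.
- exact: permutations_uniq.
- exact: iota_uniq.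
- move=> y u yn; rewrite !mem_permutations => pu.
  have [u_uniq _ _ sub] := starting_word pu.
  exact: perm_trans (toggle_perm (sub _ yn) u_uniq) pu.
- move=> y u yn; rewrite mem_permutations => /starting_word[u_uniq _ _ sub].
  by rewrite toggleK ?sub.
- move=> y u yn; rewrite mem_permutations => pu.
  rewrite /da /dd profile_toggle_self //; case: ifP => // /negbFE.
  by rewrite /is_dd /is_da /= => /eqP ->; rewrite andbN.
- by move=> y u; rewrite /da /dd /is_dd /is_da /=; case: (_ < _)%N; case: (_ < _)%N.
- move=> y u yn; rewrite mem_permutations => pu.
  have tog := toggled_unroll pu yn; rewrite /F (weight_toggled _ _ _ _ _ tog).
  congr (_ * _ ^+ _); apply: stat_toggled => [p|z zn].
    by rewrite /is_pk andbC.
  by apply: tog; move: zn; rewrite !mem_iota; lia.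
move=> y z yn zn zy u; rewrite mem_permutations => pu.
rewrite /da /dd profile_toggle_other //.
by move: zn; rewrite !mem_iota; lia.
Qed.

Theorem theorem2p5 (R : comUnitRingType) (x f g h t alpha : R) (n : nat) :
  Bpoly n x f g h t alpha =
  \sum_(0 <= k < (n %/ 2).+1)
     gammab n k f g h t alpha * x ^+ k * (1 + x) ^+ (n - 2 * k).
Proof.
pose K := weight f g h t alpha n.+1.
pose r w := stat n.+1 (fun p => p.2.1) w.
transitivity (\sum_(s : 'S_n.+1) K (word s) * x ^+ (r (word s)).-1).
  apply: eq_bigr => s _; rewrite /r -desE /= /K /weight [RHS]mulrC !mulrA.
  by rewrite lmaxpkE rmaxpkE DstatE lmaxdaE rmaxddE lmaxE rmaxE.
(* Without double descents, k = des s fixes the exponent n - 2k; grouping by k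
   gives the right-hand side. *)
transitivity (\sum_(s : 'S_n.+1 | dd s == 0%N)
    K (word s) * x ^+ des s * (1 + x) ^+ (n - 2 * des s)); last first.
  rewrite big_mkord (partition_big (fun s => inord (des s) : 'I_(n %/ 2).+1) predT) //=.
  apply: eq_bigr => k _; rewrite /gammab !mulr_suml.
  apply: eq_big => [s | s /andP[/eqP dd0 /eqP des_k]].
    rewrite inE; case: eqP => //= dd0.
    by rewrite -val_eqE /= inordK ?dd0_des.
  have <- : des s = k :> nat by rewrite -des_k inordK // dd0_des.
  congr (_ * _ * _); rewrite /K /weight.
  have -> : stat n.+1 (fun p => p.2.2 && is_dd p) (word s) = 0%N.
    apply/eqP; rewrite -leqn0 -dd0 ddE; apply: sub_count => y /=.
    by case/andP.
  by rewrite addn0 lmaxpkE rmaxpkE DstatE lmaxdaE lmaxE rmaxE.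
transitivity (\sum_(s : 'S_n.+1) K (word s) * x ^+ (r (word s)).-1 *
    (if stat n.+1 is_dd (word s) == 0%N
     then (1 + x) ^+ stat n.+1 is_da (word s) else 0)); last first.
  rewrite [RHS]big_mkcond /=; apply: eq_bigr => s _.
  rewrite -ddE; case: eqP => [dd0 | _]; last by rewrite mulr0.
  have -> : (n - 2 * des s)%N = stat n.+1 is_da (word s).
    by have := dd0_da dd0; lia.
  by rewrite /r -desE.
(* Both sides are now sums over words u, and the top letter, a peak, accounts
   for the missing descent in [(r w).-1]. *)
rewrite (sum_words n (fun w => K w * x ^+ (r w).-1)).
rewrite (sum_words n (fun w => K w * x ^+ (r w).-1 *
   (if stat n.+1 is_dd w == 0%N then (1 + x) ^+ stat n.+1 is_da w else 0))).
transitivity (\sum_(u <- permutations (iota 0 n.+1))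
    K (unroll n.+1 u) * x ^+ stat n is_pk (unroll n.+1 u)
    * x ^+ stat n is_dd (unroll n.+1 u)).
  apply: eq_big_seq => u; rewrite mem_permutations => pu.
  by rewrite /r stat_top // addn1 /= stat_pk_dd exprD mulrA.
rewrite sum_dd_to_da; apply: eq_big_seq => u; rewrite mem_permutations => pu.
rewrite /r !(stat_top _ pu) /= !addn0 addn1 /= stat_pk_dd.
by case: eqP => [-> | _]; rewrite ?addn0 ?mulr0.
Qed.
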